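(* Let $S$ be an inverse semigroup with zero and let $E$ be its semilattice of idempotents. The following are equivalent: (i) $S\ltimes\partial\widehat E$ is topologically free. (ii) $S^c\ltimes\partial\widehat E$ is topologically free. (iii) For all $s\in S^c$ and $e,f_1,\dots,f_n\in E$ with $f_i\le e\le s^{-1}s$ for all $1\le i\le n$ such that there exists $0\ne f\le e$ with $ff_i=0$ for all $1\le i\le n$, there exists $0\ne f'\le e$ with $f'f_i=0$ for all $1\le i\le n$ and $sf'=f'$.
   Context: $\widehat E$ is the space of non-zero multiplicative maps $\chi:E\to\{0,1\}$ with $\chi(0)=0$, with the topology of pointwise convergence. $\widehat E_{\max}\subseteq\widehat E$ is the set of $\chi$ with $\chi^{-1}(1)$ maximal (with respect to inclusion) among all $\chi^{-1}(1)$, $\chi\in\widehat E$, and $\partial\widehat E:=\overline{\widehat E_{\max}}$ (the space of tight filters). $s\in S$ acts via the partial homeomorphism $\{\chi:\chi(s^{-1}s)=1\}\to\{\chi:\chi(ss^{-1})=1\}$, $(s.\chi)(e)=\chi(s^{-1}es)$; this restricts to $\partial\widehat E$. $S\ltimes\partial\widehat E$ is the set of classes $[s,\chi]$ of pairs $(s,\chi)\in S\times\partial\widehat E$ with $\chi(s^{-1}s)=1$, where $[s,\chi]=[t,\psi]$ iff $\chi=\psi$ and $se=te$ for some $e\in E$ with $\chi(e)=1$; source $\chi$, range $s.\chi$, $[s,t.\chi][t,\chi]=[st,\chi]$, $[s,\chi]^{-1}=[s^{-1},s.\chi]$; the topology is the one for which the sets $\{[s,\chi]:\chi\in\partial\widehat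 E,\ \chi(s^{-1}s)=1\}$ are open and the source map restricts to homeomorphisms from them onto $\{\chi\in\partial\widehat E:\chi(s^{-1}s)=1\}$. The unit space is identified with $\partial\widehat E$. $S^c:=\{s\in S: e(ses^{-1})\ne0\text{ for all }e\in E\text{ with }0\ne e\le s^{-1}s\}$, and $S^c\ltimes\partial\widehat E:=\{[s,\chi]\in S\ltimes\partial\widehat E:s\in S^c\}$, an open subgroupoid. An étale groupoid $\mathcal G$ (not necessarily Hausdorff) is topologically free if for every open bisection $\gamma\subseteq\mathcal G\setminus\mathcal G^{(0)}$, the set $\{x\in\mathcal G^{(0)}:\mathcal G_x^x\cap\gamma\ne\emptyset\}$ has empty interior. *)

(* Defs.v *)
From HB Require Import structures.
From mathcomp Require Import all_boot.
From mathcomp Require Import boolp classical_sets functions topology.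

Set Implicit Arguments.
Unset Strict Implicit.
Unset Printing Implicit Defensive.

Local Open Scope classical_set_scope.

HB.mixin Record isInverseSemigroup0 S of Semigroup S := {
  szero : S;
  sinv : S -> S;
  mul0s : forall s : S, mul szero s = szero;
  muls0 : forall s : S, mul s szero = szero;
  mulsVs : forall s : S, mul (mul s (sinv s)) s = s;
  mulVsV : forall s : S, mul (mul (sinv s) s) (sinv s) = sinv s;
  inv_uniq : forall s t : S,
    mul (mul s t) s = s -> mul (mul t s) t = t -> t = sinv s
}.

#[short(type="inverseSemigroup0Type")]
HB.structure Definition InverseSemigroup0 :=
  {S of isInverseSemigroup0 S & Semigroup S}.

Notation "0" := (@szero _) : group_scope.
Notation "s ^-1" := (@sinv _ s) : group_scope.

Local Open Scope group_scope.

Section Idempotents.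
Variable S : inverseSemigroup0Type.
Implicit Types s t : S.

Record idem := Idem { idem_val :> Magma.sort S; idem_valP : idem_val * idem_val == idem_val }.
HB.instance Definition _ := [isSub for idem_val].
HB.instance Definition _ := [Choice of idem by <:].
Implicit Types e f : idem.

Lemma idemE e : e * e = e. Proof. exact/eqP/idem_valP. Qed.

Lemma invK s : s^-1^-1 = s.
Proof. by apply/esym/inv_uniq; rewrite ?mulVsV ?mulsVs. Qed.

Lemma inv_idemS s : s * s = s -> s^-1 = s.
Proof. by move=> ss; apply/esym/inv_uniq; rewrite ?ss. Qed.

Lemma mul_idemS s t : s * s = s -> t * t = t -> s * t * (s * t) = s * t.
Proof.
move=> ss tt; set x := (s * t)^-1.
have x1 : s * t * x * (s * t) = s * t := mulsVs (s * t).
have x2 : x * (s * t) * x = x := mulVsV (s * t).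
have xE : t * x * s = x.
  apply: inv_uniq.
    by rewrite !mulgA -(mulgA s t t) tt -(mulgA _ s s) ss -!mulgA in x1 *.
  rewrite !mulgA -(mulgA _ s s) ss -(mulgA _ t t) tt.
  by rewrite -[in RHS]x2 !mulgA.
have xx : x * x = x.
  by rewrite -{1 2}xE !mulgA -(mulgA _ s t) -(mulgA t x) -(mulgA t) x2 xE.
have -> : s * t = x by rewrite -[s * t]invK -/x inv_idemS.
exact: xx.
Qed.

Lemma idemCS s t : s * s = s -> t * t = t -> s * t = t * s.
Proof.
move=> ss tt; have st := mul_idemS ss tt; have ts := mul_idemS tt ss.
rewrite -[LHS]inv_idemS//; apply/esym/inv_uniq.
  by rewrite !mulgA -(mulgA s) tt -(mulgA _ s s) ss -mulgA.
by rewrite !mulgA -(mulgA t) ss -(mulgA _ t t) tt -mulgA.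
Qed.

Lemma idemC e f : e * f = f * e. Proof. by apply: idemCS; exact: idemE. Qed.

Lemma mulVsK s : s^-1 * s * (s^-1 * s) = s^-1 * s.
Proof. by rewrite !mulgA mulVsV. Qed.

Lemma mulsVK s : s * s^-1 * (s * s^-1) = s * s^-1.
Proof. by rewrite !mulgA mulsVs. Qed.

Lemma invM s t : (s * t)^-1 = t^-1 * s^-1.
Proof.
have c : t * t^-1 * (s^-1 * s) = s^-1 * s * (t * t^-1).
  by apply: idemCS; [exact: mulsVK|exact: mulVsK].
apply/esym/inv_uniq.
  transitivity (s * (t * t^-1 * (s^-1 * s)) * t); first by rewrite !mulgA.
  by rewrite c !mulgA mulsVs -!mulgA (mulgA t) mulsVs.
transitivity (t^-1 * (s^-1 * s * (t * t^-1)) * s^-1); first by rewrite !mulgA.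
by rewrite -c !mulgA mulVsV -!mulgA (mulgA s^-1) mulVsV.
Qed.

Lemma iconj_idemS s e : s^-1 * e * s * (s^-1 * e * s) = s^-1 * e * s.
Proof.
have c : e * (s * s^-1) = s * s^-1 * e.
  by apply: idemCS; [exact: idemE|exact: mulsVK].
rewrite !mulgA -(mulgA _ s s^-1) -(mulgA s^-1) c !mulgA mulVsV.
by rewrite -(mulgA _ e e) idemE.
Qed.

Definition idem0 : idem := Idem (introT eqP (mul0s 0)).

Definition idemM e f : idem :=
  Idem (introT eqP (mul_idemS (idemE e) (idemE f))).

(* e <= f in the natural partial order *)
Definition idem_le e f : Prop := idemM e f = e.

(* the idempotent s^-1 s *)
Definition idom s : idem := Idem (introT eqP (mulVsK s)).

(* the idempotent s^-1 e s *)
Definition iconj s e : idem := Idem (introT eqP (iconj_idemS s e)).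

Lemma idemP e f : idem_val e = idem_val f -> e = f. Proof. exact: val_inj. Qed.

Lemma idemMC e f : idemM e f = idemM f e. Proof. exact/idemP/idemC. Qed.

Lemma iconjM s e f : iconj s (idemM e f) = idemM (iconj s e) (iconj s f).
Proof.
apply/idemP => /=; have c : e * (s * s^-1) = s * s^-1 * e.
  by apply: idemCS; [exact: idemE|exact: mulsVK].
transitivity (s^-1 * (e * (s * s^-1)) * f * s); last by rewrite !mulgA.
by rewrite c !mulgA mulVsV.
Qed.

Lemma iconj0 s : iconj s idem0 = idem0.
Proof. by apply/idemP; rewrite /= muls0 mul0s. Qed.

Lemma iconj_comp s t e : iconj t (iconj s e) = iconj (s * t) e.
Proof. by apply/idemP; rewrite /= invM !mulgA. Qed.

Lemma iconj_dom s t : iconj t (idom s) = idom (s * t).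
Proof. by apply/idemP; rewrite /= invM !mulgA. Qed.

Lemma iconj_domV s : iconj s (idom s^-1) = idom s.
Proof. by apply/idemP; rewrite /= invK !mulgA mulVsV. Qed.

Lemma iconjVK s e : iconj s (iconj s^-1 e) = idemM (idemM (idom s) e) (idom s).
Proof. by apply/idemP; rewrite /= invK !mulgA. Qed.

Lemma iconjKV s e : iconj s^-1 (iconj s e) = idemM (idemM (idom s^-1) e) (idom s^-1).
Proof. by rewrite -iconjVK invK. Qed.

Lemma iconj_idem e f : iconj (idem_val e) f = idemM (idemM e f) e.
Proof. by apply/idemP; rewrite /= inv_idemS// idemE. Qed.

Lemma idom_idem e : idom (idem_val e) = e.
Proof. by apply/idemP; rewrite /= inv_idemS ?idemE. Qed.

Lemma idem_se s e : s * e = iconj s^-1 e * s.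
Proof.
have c : e * (s^-1 * s) = s^-1 * s * e.
  by apply: idemCS; [exact: idemE|exact: mulVsK].
by rewrite /= invK -[RHS]mulgA -(mulgA s e) c !mulgA mulsVs.
Qed.

Lemma iconjV_absorb s e : s^-1 * iconj s^-1 e = e * s^-1.
Proof.
have c : e * (s^-1 * s) = s^-1 * s * e.
  by apply: idemCS; [exact: idemE|exact: mulVsK].
by rewrite /= invK !mulgA -c -mulgA mulVsV.
Qed.

Lemma iconj_absorb s e : s * iconj s e = e * s.
Proof. by have := iconjV_absorb s^-1 e; rewrite invK. Qed.

Lemma eq_germ_mul s s' t t' e f : s * e = s' * e -> t * f = t' * f ->
  s * t * idemM f (iconj t e) = s' * t' * idemM f (iconj t e).
Proof.
move=> se tf; have tw : t * idemM f (iconj t e) = e * (t * f).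
  by rewrite [idem_val (idemM _ _)]idemC mulgA iconj_absorb mulgA.
have tw' : t' * idemM f (iconj t e) = e * (t * f).
  by rewrite -tw /= !mulgA tf.
by rewrite -!mulgA tw tw' !mulgA se.
Qed.

Lemma eq_germ_inv s t e : s * e = t * e -> e * s^-1 = e * t^-1.
Proof.
move=> st; have ee : (idem_val e)^-1 = idem_val e by rewrite inv_idemS ?idemE.
by rewrite -{1}ee -invM st invM ee.
Qed.

Lemma eq_germ_iconj s t e : s * e = t * e -> iconj s^-1 e = iconj t^-1 e.
Proof.
move=> st; apply/idemP; rewrite /= !invK -(idemE e) !mulgA st -!mulgA.
by rewrite (eq_germ_inv st).
Qed.

Lemma eq_germV s t e : s * e = t * e -> s^-1 * iconj s^-1 e = t^-1 * iconj s^-1 e.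
Proof.
move=> st; rewrite iconjV_absorb (eq_germ_iconj st) iconjV_absorb.
exact: eq_germ_inv.
Qed.

Definition Sc : set S :=
  [set s | forall e, e <> idem0 -> idem_le e (idom s) -> e * (s * e * s^-1) <> 0].

Lemma idemMA e f g : idemM e (idemM f g) = idemM (idemM e f) g.
Proof. by apply/idemP; rewrite /= mulgA. Qed.

Lemma idemMM e : idemM e e = e. Proof. exact/idemP/idemE. Qed.

Lemma idem0M e : idemM idem0 e = idem0. Proof. exact/idemP/mul0s. Qed.

Lemma idem_le_trans e f g : idem_le e f -> idem_le f g -> idem_le e g.
Proof. by move=> ef fg; rewrite /idem_le -[in LHS]ef -idemMA fg. Qed.

Lemma idem_leMl e f : idem_le (idemM e f) e.
Proof. by rewrite /idem_le idemMC idemMA idemMM. Qed.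

Lemma idem_leMr e f : idem_le (idemM e f) f.
Proof. by rewrite /idem_le -idemMA idemMM. Qed.

Lemma idem_le_iconj s e f : idem_le e f -> idem_le (iconj s e) (iconj s f).
Proof. by rewrite /idem_le -iconjM => ->. Qed.

Lemma iconj_le s e : idem_le (iconj s e) (idom s).
Proof. by apply/idemP; rewrite /= !mulgA -!(mulgA _ s) !mulgA -!mulgA (mulgA s) mulsVs. Qed.

Lemma iconjKV_le s e : idem_le e (idom s^-1) -> iconj s^-1 (iconj s e) = e.
Proof. by move=> es; rewrite iconjKV (idemMC _ e) !es. Qed.

Lemma ScP s : Sc s <-> forall e, e <> idem0 -> idem_le e (idom s) ->
  idemM e (iconj s^-1 e) <> idem0.
Proof.
split=> Ss e e0 es E; apply: (Ss e e0 es).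
  by have := congr1 idem_val E; rewrite /= invK.
by apply/idemP; rewrite /= invK.
Qed.

Lemma Sc_inv s : Sc s -> Sc s^-1.
Proof.
move=> /ScP Ss; apply/ScP => e e0 es E.
have fe := iconjKV_le es.
apply: (Ss (iconj s e)).
- by move=> Z; apply: e0; rewrite -fe Z iconj0.
- exact: iconj_le.
by rewrite fe idemMC; rewrite invK in E.
Qed.

Lemma Sc_mul s t : Sc s -> Sc t -> Sc (s * t).
Proof.
move=> /ScP Ss /ScP St; apply/ScP => e e0 est E.
have et : idem_le e (idom t).
  by apply: idem_le_trans est _; rewrite -iconj_dom; exact: iconj_le.
apply: (Ss (idemM e (iconj t^-1 e))); first exact: St.
  apply: idem_le_trans (idem_leMr _ _) _.
  apply: idem_le_trans (idem_le_iconj t^-1 est) _.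
  rewrite -iconj_dom iconjKV.
  exact: idem_le_trans (idem_leMl _ _) (idem_leMr _ _).
rewrite iconjM iconj_comp -invM -idemMA.
set u := iconj t^-1 e; set v := iconj s^-1 e; set w := iconj _ e.
by rewrite (idemMA u) (idemMC _ w) idemMA E idem0M.
Qed.

End Idempotents.

Arguments Sc S : clear implicits.

Lemma ptws_continuous (X Y : topologicalType) (I : Type) (f : X -> {ptws I -> Y}) :
  (forall i, continuous (fun x => f x i)) -> continuous f.
Proof.
move=> fc x; apply/cvg_sup => i U [_ [[W oW <-] /= Wx] /filterS]; apply.
by apply: (fc i x); exact: open_nbhs_nbhs.
Qed.

Section Spectrum.
Variable S : inverseSemigroup0Type.
Implicit Types (s t : S) (e f : idem S).

Definition spectrum : set {ptws idem S -> bool} :=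
  [set chi : {ptws idem S -> bool} | [/\ exists e, chi e,
    forall e f, chi (idemM e f) = chi e && chi f & chi (idem0 S) = false]].

Definition support (chi : {ptws idem S -> bool}) : set (idem S) := [set e | chi e].

Definition spectrum_max : set spectrum :=
  [set chi : spectrum | forall psi : spectrum,
    support (set_val chi) `<=` support (set_val psi) ->
    support (set_val chi) = support (set_val psi)].

(* the closure is taken inside the space of characters, not in {0,1}^E *)
Definition tight : set spectrum := closure spectrum_max.

Definition char (chi : tight) : idem S -> bool := set_val (set_val chi).

Lemma charP chi psi : char chi = char psi -> chi = psi.
Proof. by move=> cp; apply/val_inj/val_inj. Qed.

Lemma spectrumP (chi : spectrum) : spectrum (set_val chi).
Proof. exact: set_valP. Qed.

Lemma specM (chi : spectrum) e f :
  set_val chi (idemM e f) = set_val chi e && set_val chi f.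
Proof. by case: (spectrumP chi). Qed.

Lemma charM chi e f : char chi (idemM e f) = char chi e && char chi f.
Proof. exact: specM. Qed.

Lemma spec_open e : open [set chi : spectrum | set_val chi e].
Proof.
exists [set chi : {ptws idem S -> bool} | chi e] => //.
have /continuousP : continuous (fun chi : {ptws idem S -> bool} => chi e).
  exact: (@proj_continuous (idem S) (fun=> bool) e).
move=> /(_ [set x | x]); apply; rewrite openE => b /=.
by rewrite /interior nbhs_principalE => bt _ ->.
Qed.

Lemma char_open e : open [set chi | char chi e].
Proof. by exists [set chi : spectrum | set_val chi e] => //; exact: spec_open. Qed.

(* the formula (s.chi)(e) = chi(s^-1 e s) on all of {0,1}^E *)
Definition translate s (chi : {ptws idem S -> bool}) : {ptws idem S -> bool} :=
  fun e => chi (iconj s e).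

Lemma translate_continuous s : continuous (translate s).
Proof.
apply: ptws_continuous => e.
exact: (@proj_continuous (idem S) (fun=> bool) (iconj s e)).
Qed.

Lemma spec_act_subproof s (chi : spectrum) (h : set_val chi (idom s)) :
  translate s (set_val chi) \in spectrum.
Proof.
case: (spectrumP chi) => _ chiM chi0; apply/mem_set; split.
- by exists (idom s^-1); rewrite /translate iconj_domV.
- by move=> e f; rewrite /translate iconjM.
- by rewrite /translate iconj0.
Qed.

Definition spec_act s (chi : spectrum) (h : set_val chi (idom s)) : spectrum :=
  SigSub (spec_act_subproof h).

Lemma spec_actE s (chi : spectrum) (h : set_val chi (idom s)) e :
  set_val (spec_act h) e = set_val chi (iconj s e).
Proof. by []. Qed.

Lemma spec_translateK s (chi : spectrum) : set_val chi (idom s) ->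
  translate s^-1 (translate s (set_val chi)) = set_val chi.
Proof.
move=> h; apply/funext => e.
by rewrite /translate iconjVK !specM h andbT.
Qed.

Lemma spec_act_dom s (chi : spectrum) : set_val chi (idom s) ->
  translate s (set_val chi) (idom s^-1).
Proof. by rewrite /translate iconj_domV. Qed.

Lemma spec_act_max s (chi : spectrum) (h : set_val chi (idom s)) :
  spectrum_max chi -> spectrum_max (spec_act h).
Proof.
move=> chimax psi sub; apply/seteqP; split => // e psie.
have psid : set_val psi (idom s^-1) by apply: sub; exact: spec_act_dom.
have /(chimax (spec_act psid)) : support (set_val chi) `<=`
    support (set_val (spec_act psid)).
  by move=> f; rewrite /support/= -{1}(spec_translateK h); exact: sub.
rewrite predeqE => /(_ (iconj s e)) [_] /=; apply.
by rewrite /support /= spec_actE iconjKV !specM psid psie.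
Qed.

Lemma act_subproof s (chi : tight) (h : char chi (idom s)) :
  spec_act h \in tight.
Proof.
apply/mem_set => N.
rewrite nbhsE => -[_ [[W oW <-] /= Wx] sub].
pose V := [set psi : spectrum | set_val psi (idom s)] `&`
  (translate s \o set_val) @^-1` W.
have oV : open V.
  apply: openI; first exact: spec_open.
  exists (translate s @^-1` W) => //.
  by apply: open_comp => // x _; exact: translate_continuous.
have clchi : closure (@spectrum_max) (set_val chi) := set_valP chi.
have [|psi [psimax [psid Wpsi]]] := clchi V; first exact: open_nbhs_nbhs.
exists (spec_act psid); split; first exact: spec_act_max.
exact: sub.
Qed.

Definition act s (chi : tight) (h : char chi (idom s)) : tight :=
  SigSub (act_subproof h).

Lemma char_act s chi (h : char chi (idom s)) e :
  char (act h) e = char chi (iconj s e).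
Proof. by []. Qed.

Lemma act_open s (U : set tight) : open U ->
  open [set chi | exists h : char chi (idom s), U (act h)].
Proof.
move=> [V [W oW <-] <-].
exists ([set psi : spectrum | set_val psi (idom s)] `&`
  (translate s \o set_val) @^-1` W).
  apply: openI; first exact: spec_open.
  exists (translate s @^-1` W) => //.
  by apply: open_comp => // x _; exact: translate_continuous.
by apply/seteqP; split => chi; [case=> h Wh; exists h|case=> h Wh; split].
Qed.

End Spectrum.

Arguments spectrum S : clear implicits.
Arguments tight S : clear implicits.

Definition local_homeo (X Y : topologicalType) (f : X -> Y) : Prop :=
  forall x, exists U : set X, [/\ open U, U x, {in U &, injective f},
    {in U, continuous f} & forall V : set X, open V -> V `<=` U -> open (f @` V)].

(* Unit space and arrows are kept apart; the identification of the unit space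
   with a subspace of the arrows is [gunit], whose image is open. The product
   [gmul g h] is only meaningful when [src g = rng h]. *)
Record etale_groupoid := EtaleGroupoid {
  ob : topologicalType;
  arr : topologicalType;
  src : arr -> ob;
  rng : arr -> ob;
  gunit : ob -> arr;
  gmul : arr -> arr -> arr;
  ginv : arr -> arr;
  src_unit : forall x, src (gunit x) = x;
  rng_unit : forall x, rng (gunit x) = x;
  src_mul : forall g h, src g = rng h -> src (gmul g h) = src h;
  rng_mul : forall g h, src g = rng h -> rng (gmul g h) = rng g;
  gmulA : forall g h k, src g = rng h -> src h = rng k ->
    gmul g (gmul h k) = gmul (gmul g h) k;
  gmul1 : forall g, gmul g (gunit (src g)) = g;
  gmul1g : forall g, gmul (gunit (rng g)) g = g;
  src_inv : forall g, src (ginv g) = rng g;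
  rng_inv : forall g, rng (ginv g) = src g;
  gmulVg : forall g, gmul (ginv g) g = gunit (src g);
  gmulgV : forall g, gmul g (ginv g) = gunit (rng g);
  gunit_continuous : continuous gunit;
  gmul_continuous : {within [set p : arr * arr | src p.1 = rng p.2],
    continuous (fun p => gmul p.1 p.2)};
  ginv_continuous : continuous ginv;
  src_local_homeo : local_homeo src
}.

Section TopologicalFreeness.
Variable G : etale_groupoid.

Definition isotropy (x : ob G) : set (arr G) := [set g | src g = x /\ rng g = x].

(* Since src and rng are local homeomorphisms, an open set on which they are
   injective is mapped by them homeomorphically onto open sets. *)
Definition open_bisection (gamma : set (arr G)) : Prop :=
  [/\ open gamma, {in gamma &, injective (@src G)} &
      {in gamma &, injective (@rng G)}].

Definition topologically_free : Prop :=
  forall gamma : set (arr G), open_bisection gamma ->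
    gamma `<=` ~` range (@gunit G) ->
    interior [set x : ob G | isotropy x `&` gamma !=set0] = set0.

End TopologicalFreeness.

Section OpenSubgroupoid.
Variables (G : etale_groupoid) (H : set (arr G)).
Hypotheses (oH : open H) (H1 : forall x, H (gunit x))
  (HM : forall g h, H g -> H h -> src g = rng h -> H (gmul g h))
  (HV : forall g, H g -> H (ginv g)).

Let HP (g : H) : H (val g). Proof. exact: set_valP. Qed.

Let rsrc (g : H) : ob G := src (set_val g).
Let rrng (g : H) : ob G := rng (set_val g).
Let runit (x : ob G) : H := SigSub (mem_set (H1 x)).
Let rinv (g : H) : H := SigSub (mem_set (HV (HP g))).
Let rmul (g h : H) : H :=
  match pselect (rsrc g = rrng h) with
  | left gh => SigSub (mem_set (HM (HP g) (HP h) gh))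
  | right _ => g
  end.

Let rmulE g h : rsrc g = rrng h -> set_val (rmul g h) = gmul (set_val g) (set_val h).
Proof. by rewrite /rmul; case: pselect. Qed.

Let sub_continuous (X : topologicalType) (f : X -> H) :
  continuous (set_val \o f) -> continuous f.
Proof. exact: continuous_comp_initial. Qed.

Let val_continuous : continuous (set_val : H -> arr G).
Proof. exact: initial_continuous. Qed.

Let rmul_continuous : {within [set p : H * H | rsrc p.1 = rrng p.2],
  continuous (fun p => rmul p.1 p.2)}.
Proof.
apply/subspace_continuousP => -[g h] /= gh N [_ [[W oW <-] /= Wgh] sub].
rewrite rmulE// in Wgh.
have /subspace_continuousP/(_ (set_val g, set_val h) gh) /= := @gmul_continuous G.
move=> /(_ W (open_nbhs_nbhs (conj oW Wgh))).
rewrite /nbhs /= => -[[A B] /= [nA nB] AB].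
exists (set_val @^-1` A, set_val @^-1` B) => /=.
  by split; exact: val_continuous.
move=> [g' h'] /= [Ag Bh] gh'; apply: sub => /=.
by rewrite rmulE//; exact: (AB (set_val g', set_val h')).
Qed.

Let rsrc_local_homeo : local_homeo rsrc.
Proof.
move=> g; have [U [oU Ug Ui Uc Uo]] := src_local_homeo (set_val g).
exists (set_val @^-1` U); split => //.
- by exists U.
- move=> x y; rewrite !inE => Ux Uy xy; apply: val_inj.
  by apply: Ui; rewrite ?inE.
- move=> x; rewrite inE => Ux; apply: continuous_comp.
    exact: val_continuous.
  by apply: Uc; rewrite inE.
move=> _ [W oW <-] WU.
have -> : rsrc @` (set_val @^-1` W) = @src G @` (W `&` H `&` U).
  apply/seteqP; split=> _ [x Wx <-].
    exists (set_val x) => //; split; last exact: WU.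
    by split => //; exact: HP.
  by case: Wx => -[Wx Hx] Ux; exists (SigSub (mem_set Hx)).
by apply: Uo; [do 2?apply: openI|move=> x []].
Qed.

Definition open_subgroupoid : etale_groupoid.
Proof.
refine (@EtaleGroupoid (ob G) H rsrc rrng runit rmul rinv
  _ _ _ _ _ _ _ _ _ _ _ _ rmul_continuous _ rsrc_local_homeo).
- by move=> x; exact: src_unit.
- by move=> x; exact: rng_unit.
- by move=> g h gh; rewrite /rsrc rmulE// src_mul.
- by move=> g h gh; rewrite /rrng rmulE// rng_mul.
- move=> g h k gh hk; apply: val_inj; rewrite -!set_valE !rmulE//.
  + by rewrite gmulA.
  + by rewrite /rsrc rmulE// src_mul.
  + by rewrite /rrng rmulE// rng_mul.
- by move=> g; apply: val_inj; rewrite -!set_valE rmulE ?gmul1// /rrng rng_unit.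
- by move=> g; apply: val_inj; rewrite -!set_valE rmulE ?gmul1g// /rsrc src_unit.
- by move=> g; exact: src_inv.
- by move=> g; exact: rng_inv.
- by move=> g; apply: val_inj; rewrite -!set_valE rmulE ?gmulVg// /rsrc src_inv.
- by move=> g; apply: val_inj; rewrite -!set_valE rmulE ?gmulgV// /rrng rng_inv.
- by apply: sub_continuous; exact: gunit_continuous.
- apply: sub_continuous => g; apply: (@continuous_comp H _ _ set_val (@ginv G)).
    exact: val_continuous.
  exact: ginv_continuous.
Defined.

End OpenSubgroupoid.

Section Germs.
Variable S : inverseSemigroup0Type.
Implicit Types (s t : S) (e f : idem S) (chi psi : tight S).

Record germ_rep := GermRep {
  rep_pair : S * tight S;
  rep_dom : char rep_pair.2 (idom rep_pair.1)
}.
HB.instance Definition _ := [isSub for rep_pair].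
HB.instance Definition _ := [Choice of germ_rep by <:].

Definition germ_eq (p q : germ_rep) : bool :=
  `[< (rep_pair p).2 = (rep_pair q).2 /\
      exists e, (rep_pair p).1 * e = (rep_pair q).1 * e /\ char (rep_pair p).2 e >].

Lemma germ_eq_refl : reflexive germ_eq.
Proof. by move=> [[s chi] h]; apply/asboolP; split=> //; exists (idom s). Qed.

Lemma germ_eq_sym : symmetric germ_eq.
Proof.
suff H p q : germ_eq p q -> germ_eq q p by move=> p q; apply/idP/idP; exact: H.
by move=> /asboolP[E [e [se ce]]]; apply/asboolP; split=> //; exists e; rewrite -E.
Qed.

Lemma germ_eq_trans : transitive germ_eq.
Proof.
move=> q p r /asboolP[pq [e [pqe ce]]] /asboolP[qr [f [qrf cf]]].
apply/asboolP; split; first by rewrite pq.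
exists (idemM e f); split; last by rewrite charM ce pq.
by rewrite /= mulgA pqe -mulgA idemC mulgA qrf mulgA.
Qed.

Canonical germ_equiv := EquivRel germ_eq germ_eq_refl germ_eq_sym germ_eq_trans.

Local Open Scope quotient_scope.

Definition germs := {eq_quot germ_eq}.
HB.instance Definition _ := Choice.on germs.
HB.instance Definition _ := EqQuotient.on germs.

(* [germ h] is the class [s, chi] *)
Definition germ s chi (h : char chi (idom s)) : germs :=
  \pi_germs (@GermRep (s, chi) h).

Lemma germ_ind (g : germs) : exists s chi (h : char chi (idom s)), g = germ h.
Proof.
elim/quotW: g => -[[s chi] h].
by exists s, chi, h.
Qed.

Lemma germP s t chi psi (h : char chi (idom s)) (k : char psi (idom t)) :
  germ h = germ k <-> chi = psi /\ exists e, s * e = t * e /\ char chi e.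
Proof.
split; first by move=> /eqmodP/asboolP.
by move=> st; apply/eqmodP/asboolP.
Qed.

(* The unique topology making each {[s, chi] : chi(s^-1 s) = 1} open and
   homeomorphic to {chi : chi(s^-1 s) = 1} via the source map: a set is open iff
   its trace on each of these sets has open image under the source map. See
   [germ_nbhs_open] and [germ_src_homeo]. *)
Definition germ_open (A : set germs) : Prop :=
  forall s, open [set chi | exists h : char chi (idom s), A (germ h)].

Lemma germ_openT : germ_open setT.
Proof.
move=> s; rewrite [X in open X](_ : _ = [set chi | char chi (idom s)]).
  exact: char_open.
by apply/seteqP; split => chi; [by case|by move=> h; exists h].
Qed.

Lemma germ_openI (A B : set germs) :
  germ_open A -> germ_open B -> germ_open (A `&` B).
Proof.
move=> oA oB s; have := openI (oA s) (oB s); congr open.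
apply/seteqP; split => chi; first by case=> -[h Ah] [k Bk]; exists h; split => //;
  rewrite (bool_irrelevance h k).
by case=> h [Ah Bh]; split; exists h.
Qed.

Lemma germ_open_bigcup (I : Type) (A : I -> set germs) :
  (forall i, germ_open (A i)) -> germ_open (\bigcup_i A i).
Proof.
move=> oA s; have := bigcup_open (fun i (_ : setT i) => oA i s); congr open.
apply/seteqP; split => chi.
  by case=> i _ [h Ah]; exists h; exists i.
by case=> h [i _ Ah]; exists i => //; exists h.
Qed.

HB.instance Definition _ :=
  isOpenTopological.Build germs germ_openT germ_openI germ_open_bigcup.

(* {[s, chi] : chi in U, chi(s^-1 s) = 1} *)
Definition germ_nbhs s (U : set (tight S)) : set germs :=
  [set g | exists chi (h : char chi (idom s)), U chi /\ g = germ h].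

Lemma germ_nbhs_open s (U : set (tight S)) : open U -> open (germ_nbhs s U).
Proof.
move=> oU; suff : germ_open (germ_nbhs s U) by [].
move=> t; rewrite [X in open X](_ : _ = \bigcup_(e in [set e : idem S | s * e = t * e])
  (U `&` [set chi | char chi (idom s)] `&` [set chi | char chi (idom t)]
   `&` [set chi | char chi e])).
  by apply: bigcup_open => e _; do ?apply: openI => //; exact: char_open.
apply/seteqP; split => chi /=.
  case=> k [psi [h [Upsi /germP[E [e [te ce]]]]]]; subst psi.
  by exists e.
case=> e se [[[Uchi h] k] ce]; exists k, chi, h; split => //.
by apply/germP; split => //; exists e.
Qed.

Definition germ_src (g : germs) : tight S := (rep_pair (repr g)).2.
Definition germ_rng (g : germs) : tight S := act (rep_dom (repr g)).

Lemma germ_reprE (g : germs) : g = @germ (rep_pair (repr g)).1 (germ_src g) (rep_dom (repr g)).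
Proof.
transitivity (\pi_germs (repr g)); first by rewrite reprK.
by congr (\pi_germs _); apply: val_inj => /=; exact: surjective_pairing.
Qed.

Lemma germ_srcE s chi (h : char chi (idom s)) : germ_src (germ h) = chi.
Proof. by have /germP[] := germ_reprE (germ h). Qed.

Lemma char_iconj s t e chi f : s * e = t * e -> char chi e ->
  char chi (iconj s f) = char chi (iconj t f).
Proof.
move=> st ce.
have H u : char chi (iconj u f) = char chi (iconj (u * e) f).
  by rewrite -iconj_comp iconj_idem !charM ce andbT.
by rewrite H st -H.
Qed.

Lemma germ_rngE s chi (h : char chi (idom s)) : germ_rng (germ h) = act h.
Proof.
have /germP[E [e [se ce]]] := germ_reprE (germ h).
apply/charP/funext => f; rewrite !char_act -/(germ_src _) germ_srcE.
by apply/esym; exact: char_iconj se ce.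
Qed.

Lemma germ_unit_subproof chi : exists e, char chi e.
Proof. by case: (spectrumP (set_val chi)). Qed.

Lemma germ_unit_dom chi (e := projT1 (cid (germ_unit_subproof chi))) :
  char chi (idom (idem_val e)).
Proof. by rewrite idom_idem; exact: (projT2 (cid (germ_unit_subproof chi))). Qed.

Definition germ_unit chi : germs := germ (germ_unit_dom chi).

Lemma germ_unitE e chi (h : char chi (idom (idem_val e))) : germ_unit chi = germ h.
Proof.
have he := h; rewrite idom_idem in he.
apply/germP; split => //; move: (cid _) => -[f cf] /=.
exists (idemM e f); rewrite charM he cf /=; split => //.
by rewrite [RHS]mulgA idemE (idemC e f) mulgA idemE.
Qed.

Lemma germ_inv_dom s chi (h : char chi (idom s)) : char (act h) (idom s^-1).
Proof. by rewrite char_act iconj_domV. Qed.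

Definition germ_inv (g : germs) : germs := germ (germ_inv_dom (rep_dom (repr g))).

Lemma germ_eqP s t chi psi (h : char chi (idom s)) (k : char psi (idom t)) e :
  chi = psi -> s * e = t * e -> char chi e -> germ h = germ k.
Proof. by move=> cp st ce; apply/germP; split => //; exists e. Qed.

Lemma germ_invE s chi (h : char chi (idom s)) :
  germ_inv (germ h) = germ (germ_inv_dom h).
Proof.
have /germP[E [e [se ce]]] := germ_reprE (germ h).
rewrite /germ_inv; set r := repr _ in E se *; apply: (@germ_eqP _ _ _ _ _ _ (iconj s^-1 e)).
- exact: germ_rngE.
- by rewrite -(eq_germV se) (eq_germ_iconj se).
have -> : act (rep_dom r) = act h by exact: germ_rngE.
by rewrite char_act iconjVK !charM h ce.
Qed.

Lemma germ_mul_dom s t chi (k : char chi (idom t)) :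
  char (act k) (idom s) -> char chi (idom (s * t)).
Proof. by rewrite char_act iconj_dom. Qed.

Lemma germ_mul_subproof (g h : germs) : germ_src g = germ_rng h ->
  char (act (rep_dom (repr h))) (idom (rep_pair (repr g)).1).
Proof. by move=> gh; rewrite -[act _]gh; exact: rep_dom. Qed.

Definition germ_mul (g h : germs) : germs :=
  match pselect (germ_src g = germ_rng h) with
  | left gh => germ (germ_mul_dom (germ_mul_subproof gh))
  | right _ => g
  end.

Lemma germ_mulE s t chi (k : char chi (idom t)) (h : char (act k) (idom s)) :
  germ_mul (germ h) (germ k) = germ (germ_mul_dom h).
Proof.
rewrite /germ_mul; case: pselect; last by rewrite germ_srcE germ_rngE.
move=> gh; move: (germ_mul_subproof gh) => d.
have /germP[E1 [e [se ce]]] := germ_reprE (germ h).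
have /germP[E2 [f [tf cf]]] := germ_reprE (germ k).
set p := repr (germ h) in E1 se d *; set q := repr (germ k) in E2 tf d *.
apply/esym; apply: (@germ_eqP _ _ _ _ _ _ (idemM f (iconj t e))).
- by rewrite E2.
- by rewrite (eq_germ_mul se tf).
by rewrite charM cf -(char_act k).
Qed.

Lemma germ_mulE' s t chi psi (h : char psi (idom s)) (k : char chi (idom t))
    (d : char chi (idom (s * t))) :
  psi = act k -> germ_mul (germ h) (germ k) = germ d.
Proof.
move=> E; subst psi; rewrite germ_mulE.
by congr (germ _); exact: bool_irrelevance.
Qed.

Lemma act_mul s t chi (k : char chi (idom t)) (h : char (act k) (idom s)) :
  act (germ_mul_dom h) = act h.
Proof. by apply/charP/funext => f; rewrite !char_act iconj_comp. Qed.

Lemma act_idem e chi (h : char chi (idom (idem_val e))) : act h = chi.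
Proof.
have he := h; rewrite idom_idem in he.
by apply/charP/funext => f; rewrite char_act iconj_idem !charM he andbT.
Qed.

Lemma actK s chi (h : char chi (idom s)) : act (germ_inv_dom h) = chi.
Proof.
by apply/charP/funext => f; rewrite !char_act iconjVK !charM h andbT.
Qed.

Lemma germ_composable (g h : germs) : germ_src g = germ_rng h ->
  exists s t chi (k : char chi (idom t)) (l : char (act k) (idom s)),
    g = germ l /\ h = germ k.
Proof.
have [s [psi [l ->]]] := germ_ind g; have [t [chi [k ->]]] := germ_ind h.
rewrite germ_srcE germ_rngE => E; subst psi.
by exists s, t, chi, k, l.
Qed.

Lemma germ_src_unit chi : germ_src (germ_unit chi) = chi.
Proof. exact: germ_srcE. Qed.

Lemma germ_rng_unit chi : germ_rng (germ_unit chi) = chi.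
Proof. by rewrite /germ_unit germ_rngE act_idem. Qed.

Lemma germ_src_mul g h : germ_src g = germ_rng h ->
  germ_src (germ_mul g h) = germ_src h.
Proof.
by move=> /germ_composable[s [t [chi [k [l [-> ->]]]]]]; rewrite germ_mulE !germ_srcE.
Qed.

Lemma germ_rng_mul g h : germ_src g = germ_rng h ->
  germ_rng (germ_mul g h) = germ_rng g.
Proof.
move=> /germ_composable[s [t [chi [k [l [-> ->]]]]]].
by rewrite germ_mulE !germ_rngE act_mul.
Qed.

Lemma germ_mulA g h k : germ_src g = germ_rng h -> germ_src h = germ_rng k ->
  germ_mul g (germ_mul h k) = germ_mul (germ_mul g h) k.
Proof.
have [s [psi [l ->]]] := germ_ind g.
move=> E /germ_composable[t [u [chi [d [c [Eh Ek]]]]]]; subst h k.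
move: E; rewrite germ_srcE germ_rngE => E; subst psi.
have D : char chi (idom (s * (t * u))).
  by rewrite mulgA; exact: germ_mul_dom (germ_mul_dom l).
rewrite !germ_mulE (germ_mulE' _ D) ?act_mul//.
by apply: (@germ_eqP _ _ _ _ _ _ (idom (s * (t * u)))) => //; rewrite -[s * t * u]mulgA.
Qed.

Lemma germ_mul1 g : germ_mul g (germ_unit (germ_src g)) = g.
Proof.
have [s [chi [h ->]]] := germ_ind g; rewrite germ_srcE.
have h' : char chi (idom (idem_val (idom s))) by rewrite idom_idem.
have sE : s * idem_val (idom s) = s by rewrite /= mulgA mulsVs.
have hd : char chi (idom (s * idem_val (idom s))) by rewrite sE.
by rewrite (germ_unitE h') (germ_mulE' _ hd) ?act_idem//;
  apply: (@germ_eqP _ _ _ _ _ _ (idom s)) => //; rewrite sE.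
Qed.

Lemma germ_mul1g g : germ_mul (germ_unit (germ_rng g)) g = g.
Proof.
have [s [chi [h ->]]] := germ_ind g; rewrite germ_rngE.
have h' : char (act h) (idom (idem_val (idom s^-1))).
  by rewrite idom_idem char_act iconj_domV.
by rewrite (germ_unitE h') germ_mulE;
  apply: (@germ_eqP _ _ _ _ _ _ (idom s)) => //=; rewrite invK !mulgA !mulsVs.
Qed.

Lemma germ_src_inv g : germ_src (germ_inv g) = germ_rng g.
Proof.
by have [s [chi [h ->]]] := germ_ind g; rewrite germ_invE germ_srcE germ_rngE.
Qed.

Lemma germ_rng_inv g : germ_rng (germ_inv g) = germ_src g.
Proof.
have [s [chi [h ->]]] := germ_ind g.
by rewrite germ_invE germ_srcE germ_rngE actK.
Qed.

Lemma germ_mulVg g : germ_mul (germ_inv g) g = germ_unit (germ_src g).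
Proof.
have [s [chi [h ->]]] := germ_ind g; rewrite germ_invE germ_srcE.
have h' : char chi (idom (idem_val (idom s))) by rewrite idom_idem.
rewrite (germ_unitE h') germ_mulE.
by congr (germ _); exact: bool_irrelevance.
Qed.

Lemma germ_mulgV g : germ_mul g (germ_inv g) = germ_unit (germ_rng g).
Proof.
have [s [chi [h ->]]] := germ_ind g; rewrite germ_invE germ_rngE.
have h' : char (act h) (idom (idem_val (idom s^-1))).
  by rewrite idom_idem char_act iconj_domV.
have hd : char (act h) (idom (s * s^-1)) by rewrite -[s in s * _]invK.
rewrite (germ_unitE h') (germ_mulE' _ hd) ?actK//.
by apply: (@germ_eqP _ _ _ _ _ _ (idom s^-1)) => //=; rewrite ?invK // char_act iconj_domV.
Qed.

Lemma germ_nbhs_sub s chi (h : char chi (idom s)) (N : set germs) :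
  nbhs (germ h) N ->
  exists U, [/\ open U, U chi & germ_nbhs s U `<=` N].
Proof.
rewrite nbhsE => -[W [oW Wh] WN].
have oW' : germ_open W by [].
exists [set psi | exists k : char psi (idom s), W (germ k)]; split => //.
  by exists h.
move=> _ [psi [k [[k' Wk] ->]]]; apply: WN.
by rewrite (bool_irrelevance k k').
Qed.

Lemma germ_nbhs_in s chi (h : char chi (idom s)) (U : set (tight S)) :
  open U -> U chi -> nbhs (germ h) (germ_nbhs s U).
Proof.
move=> oU Uchi; apply: open_nbhs_nbhs; split; first exact: germ_nbhs_open.
by exists chi, h.
Qed.

Lemma germ_unit_continuous : continuous germ_unit.
Proof.
move=> chi N /germ_nbhs_sub[U [oU Uchi sub]].
set e := projT1 _ in sub.
have : open (U `&` [set psi | char psi (idom (idem_val e))]).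
  by apply: openI => //; exact: char_open.
move=> oV; apply: filterS (open_nbhs_nbhs (conj oV _)).
  by move=> psi [Upsi k] /=; apply: sub; exists psi, k; rewrite (germ_unitE k).
by split => //; exact: germ_unit_dom.
Qed.

Lemma germ_inv_continuous : continuous germ_inv.
Proof.
move=> g N; have [s [chi [h ->]]] := germ_ind g.
rewrite germ_invE => /germ_nbhs_sub[U [oU Uchi sub]].
have := germ_nbhs_in h (act_open s oU) (ex_intro _ h Uchi).
apply: filterS => _ [psi [k [[k' Uk] ->]]]; apply: sub => /=.
rewrite germ_invE; exists (act k), (germ_inv_dom k); split => //.
by rewrite (bool_irrelevance k k').
Qed.

Lemma germ_mul_continuous :
  {within [set p : germs * germs | germ_src p.1 = germ_rng p.2],
    continuous (fun p => germ_mul p.1 p.2)}.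
Proof.
apply/subspace_continuousP => -[g h] /= gh N nN.
have {nN} : nbhs (germ_mul g h) N by [].
have [s [t [chi [k [l [Eg Eh]]]]]] := germ_composable gh.
rewrite Eg Eh germ_mulE => /germ_nbhs_sub[U [oU Uchi sub]].
have n1 := germ_nbhs_in l openT I; have n2 := germ_nbhs_in k oU Uchi.
exists (germ_nbhs s setT, germ_nbhs t U) => //=.
move=> [_ _] /= [[psi' [l' [_ ->]]] [psi [k' [Upsi ->]]]].
rewrite germ_srcE germ_rngE => E; subst psi'.
apply: (sub (germ_mul (germ l') (germ k'))); rewrite germ_mulE.
by exists psi, (germ_mul_dom l').
Qed.

Lemma germ_src_homeo s (D := germ_nbhs s setT) :
  [/\ germ_src @` D = [set chi | char chi (idom s)],
      {in D &, injective germ_src}, {in D, continuous germ_src} &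
      forall V : set germs, open V -> V `<=` D -> open (germ_src @` V)].
Proof.
split.
- apply/seteqP; split => [_ [_ [psi [k [_ ->]]] <-]|psi k].
    by rewrite germ_srcE.
  by exists (germ k); [exists psi, k|rewrite germ_srcE].
- move=> _ _ /set_mem[psi [k [_ ->]]] /set_mem[psi' [k' [_ ->]]].
  rewrite !germ_srcE => E; subst psi'.
  by rewrite (bool_irrelevance k k').
- move=> _ /set_mem[psi [k [_ ->]]] N; rewrite germ_srcE nbhsE => -[W [oW Wpsi] WN].
  apply: filterS (germ_nbhs_in k oW Wpsi) => _ [psi' [k' [W' ->]]] /=.
  by rewrite germ_srcE; exact: WN.
move=> V oV Vs; have oV' : germ_open V by [].
rewrite [X in open X](_ : _ = [set psi | exists k : char psi (idom s), V (germ k)]).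
  exact: oV'.
apply/seteqP; split => [_ [g' Vg' <-]|psi [k Vk]].
  have [psi [k [_ Eg]]] := Vs _ Vg'.
  by rewrite Eg germ_srcE in Vg' *; exists k.
by exists (germ k) => //; rewrite germ_srcE.
Qed.

Lemma germ_src_local_homeo : local_homeo germ_src.
Proof.
move=> g; have [s [chi [h ->]]] := germ_ind g.
have [_ inj cont op] := germ_src_homeo s.
exists (germ_nbhs s setT); split => //.
- by apply: germ_nbhs_open; exact: openT.
- by exists chi, h.
Qed.

Definition tight_groupoid : etale_groupoid :=
  EtaleGroupoid germ_src_unit germ_rng_unit germ_src_mul germ_rng_mul germ_mulA
    germ_mul1 germ_mul1g germ_src_inv germ_rng_inv germ_mulVg germ_mulgV
    germ_unit_continuous germ_mul_continuous germ_inv_continuous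
    germ_src_local_homeo.

Definition Sc_germs : set (arr tight_groupoid) :=
  [set g : germs | exists s chi (h : char chi (idom s)), Sc S s /\ g = germ h].

Lemma Sc_germs_open : open Sc_germs.
Proof.
rewrite [X in open X](_ : _ = \bigcup_(s in Sc S) (germ_nbhs s setT)).
  by apply: bigcup_open => s _; apply: germ_nbhs_open; exact: openT.
apply/seteqP; split => g.
  by move=> [s [chi [h [Scs ->]]]]; exists s => //; exists chi, h.
by move=> [s Scs [chi [h [_ ->]]]]; exists s, chi, h.
Qed.

Lemma Sc_germs_unit chi : Sc_germs (germ_unit chi).
Proof.
set e := projT1 (cid (germ_unit_subproof chi)).
exists (idem_val e), chi, (germ_unit_dom chi); split => // f f0 fe.
have ef : f * e = f.
  by move: fe; rewrite idom_idem => /(congr1 (@idem_val S)).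
rewrite inv_idemS ?idemE// [e * f]idemC ef ef idemE => E; apply: f0.
exact: idemP.
Qed.

Lemma Sc_germs_mul g h : Sc_germs g -> Sc_germs h -> germ_src g = germ_rng h ->
  Sc_germs (germ_mul g h).
Proof.
move=> [s [psi [l [Ss ->]]]] [t [chi [k [St ->]]]].
rewrite germ_srcE germ_rngE => E; subst psi; rewrite germ_mulE.
exists (s * t), chi, (germ_mul_dom l); split => //; exact: Sc_mul.
Qed.

Lemma Sc_germs_inv g : Sc_germs g -> Sc_germs (germ_inv g).
Proof.
move=> [s [chi [h [Ss ->]]]]; rewrite germ_invE.
by exists s^-1, (act h), (germ_inv_dom h); split => //; exact: Sc_inv.
Qed.

Definition Sc_groupoid : etale_groupoid :=
  open_subgroupoid Sc_germs_open Sc_germs_unit Sc_germs_mul Sc_germs_inv.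

End Germs.

Arguments tight_groupoid S : clear implicits.
Arguments Sc_groupoid S : clear implicits.

(* Main.v *)
Require Import Defs.
From mathcomp Require Import all_boot.
From mathcomp Require Import boolp classical_sets functions topology.
(* makes [support] the support of a character, and [0], [^-1] those of
   inverse semigroups *)
Import Defs.

(** A nonempty open set of tight filters contains a maximal filter, and the sets
    [{psi | psi g = 1}] with [g] in a maximal filter [chi] form a neighbourhood
    base at [chi]: if [chi f = 0], maximality gives [h] with [chi h = 1] and
    [h f = 0], so that a condition [psi f = 0] follows from [psi h = 1]
    ([spectrum_max_base], [tight_local_base]). Conversely every nonzero
    idempotent lies in a maximal filter ([exists_spectrum_max]). Hence every
    nonempty open set of tight filters contains a nonempty set
    [{psi | psi g = 1}], and questions on open sets of tight filters become
    questions on nonzero idempotents.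

    The germ [[s, chi]] is a unit iff [s f = f] for some [f] with [chi f = 1]
    ([germ_unitP]). The link with [Sc S] is that [s] in [Sc S] acts trivially
    on its whole domain: a maximal filter is fixed because each idempotent that
    meets all its members belongs to it, and fixed points are closed
    ([Sc_act]). Conversely, if [s] fixes all tight filters containing [g], where
    [g <= s^-1 s], then [s g] is in [Sc S] ([fixed_mul_Sc]).

    Topological freeness passes to open subgroupoids. If the subgroupoid is
    topologically free and [s] in [Sc S] satisfies [s g' <> g'] for all
    nonzero [g' <= g], where [g <= s^-1 s] is nonzero, the germs
    of [s] over [{psi | psi g = 1}] form an open bisection without units that
    consists of isotropy, which is absurd. Finally, if an open bisection without
    units has isotropy over a nonempty open set, it contains all germs of some
    [s] over some [{psi | psi g = 1}], and [s] fixes these filters; so [s g] is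
    in [Sc S], the third condition (with no [f_i]) gives a nonzero [f' <= g]
    with [s f' = f'], and the germ of [s] at a filter containing [f'] is a unit
    of the bisection. *)

Set Implicit Arguments.
Unset Strict Implicit.
Unset Printing Implicit Defensive.

Local Open Scope classical_set_scope.
Local Open Scope group_scope.

(** * Filters of idempotents and maximal characters *)

Section Filters.
Variable S : inverseSemigroup0Type.
Implicit Types (s t : S) (e f g h : idem S) (A : set (idem S)).

Lemma idemMCA e f g : idemM e (idemM f g) = idemM f (idemM e g).
Proof. by rewrite idemMA (idemMC e) -idemMA. Qed.

Lemma idem_leM e f g : idem_le g e -> idem_le g f -> idem_le g (idemM e f).
Proof. by rewrite /idem_le idemMA => -> ->. Qed.

Lemma idem_le0 e : idem_le e (idem0 S) -> e = idem0 S.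
Proof. by rewrite /idem_le idemMC idem0M. Qed.

(** Proper filters, the supports of the characters in [spectrum S]; the empty
    set is allowed. *)
Definition proper_filter A : Prop :=
  [/\ forall e f, A e -> A f -> A (idemM e f),
      forall e f, A e -> idem_le e f -> A f & ~ A (idem0 S)].

Lemma proper_filter_spectrum A : proper_filter A -> A !=set0 ->
  exists chi : spectrum S, support (set_val chi) = A.
Proof.
move=> [AM Aup A0] [e Ae].
have H : spectrum S ((fun x => `[< A x >]) : {ptws idem S -> bool}).
  split; first by exists e; apply/asboolP.
    move=> x y; apply/asboolP/andP => [Axy|[/asboolP Ax /asboolP Ay]].
      split; apply/asboolP; apply: Aup Axy _; [exact: idem_leMl|exact: idem_leMr].
    exact: AM.
  by apply/asboolP.
exists (SigSub (mem_set H)) => //.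
by apply/seteqP; split => x; rewrite /support /=; move/asboolP.
Qed.

Lemma support_proper_filter (chi : spectrum S) : proper_filter (support (set_val chi)).
Proof.
have [_ _ chi0] := spectrumP chi; rewrite /support.
split => /= [e f|e f|]; last by rewrite chi0.
  by rewrite specM => -> ->.
by move=> + ef; rewrite -{1}ef specM => /andP[].
Qed.

(** Ultrafilter lemma for the semilattice of idempotents. *)
Lemma exists_spectrum_max e : e <> idem0 S ->
  exists2 chi : spectrum S, spectrum_max chi & set_val chi e.
Proof.
move=> e0.
(* [Zorn_bigcup] also asks for an upper bound of the empty chain, hence [e] is
   only required in nonempty filters *)
pose P A := proper_filter A /\ forall f, A f -> A e.
have [F FP Ftot|A [[Af Ae] Amax]] := @Zorn_bigcup _ P.
  split; last by move=> f [X FX Xf]; exists X => //; exact: (FP X FX).2 Xf.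
  split => [x y [X FX Xx] [Y FY Yy]|x y [X FX Xx] xy|[X /FP[[_ _ X0] _] /X0//]].
    have [XY|YX] := Ftot _ _ FX FY.
      by exists Y => //; have [[YM _ _] _] := FP _ FY; apply: YM => //; exact: XY.
    by exists X => //; have [[XM _ _] _] := FP _ FX; apply: XM => //; exact: YX.
  by exists X => //; have [[_ Xup _] _] := FP _ FX; exact: Xup xy.
have Amax' B : P B -> A `<=` B -> A = B.
  move=> PB AB; apply/seteqP; split=> //; apply: contrapT => BA.
  by apply: (Amax B) PB; split.
have Ae' : A e.
  apply: contrapT => nAe.
  have Pe : P [set x | idem_le e x].
    split; last by move=> *; exact: idemMM.
    split => /= [x y|x y|/idem_le0//]; first exact: idem_leM.
    exact: idem_le_trans.
  by apply: (nAe); rewrite (Amax' _ Pe); [exact: idemMM|move=> f /Ae].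
have [chi chiA] := proper_filter_spectrum Af (ex_intro _ e Ae').
have chie : set_val chi e by move: Ae'; rewrite -chiA.
exists chi => // psi sub; rewrite chiA; rewrite chiA in sub.
apply: Amax' => //; split; first exact: support_proper_filter.
by move=> _ _; exact: sub.
Qed.

Lemma spectrum_max_mem (chi : spectrum S) e : spectrum_max chi ->
  (forall h, set_val chi h -> idemM h e <> idem0 S) -> set_val chi e.
Proof.
move=> chimax meet; have [[k chik] _ _] := spectrumP chi.
(* the filter generated by [chi] and [e] *)
pose A : set (idem S) := [set x | exists2 h, set_val chi h & idem_le (idemM h e) x].
have Af : proper_filter A.
  split => [x y [h ch hx] [h' ch' hy]|x y [h ch hx] xy|[h ch /idem_le0]].
  - exists (idemM h h'); first by rewrite specM ch.
    apply: idem_leM.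
      by rewrite -idemMA idemMCA; exact: idem_le_trans (idem_leMr _ _) hx.
    by rewrite -idemMA; exact: idem_le_trans (idem_leMr _ _) hy.
  - by exists h => //; exact: idem_le_trans xy.
  - exact: meet.
have [psi psiA] : exists psi : spectrum S, support (set_val psi) = A.
  by apply: proper_filter_spectrum => //; exists e, k => //; exact: idem_leMr.
have /chimax : support (set_val chi) `<=` support (set_val psi).
  by rewrite psiA => x cx; exists x => //; exact: idem_leMl.
rewrite psiA => chiA; suff: support (set_val chi) e by [].
by rewrite chiA; exists k => //; exact: idem_leMr.
Qed.

Lemma spectrum_max_disjoint (chi : spectrum S) e : spectrum_max chi ->
  ~~ set_val chi e -> exists2 h, set_val chi h & idemM h e = idem0 S.
Proof.
move=> chimax /negP ne; apply: contrapT => H; apply/ne.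
by apply: spectrum_max_mem => // h ch he; apply: H; exists h.
Qed.

(** * Open sets of tight filters *)

Lemma spectrum_max_base (chi : spectrum S) (V : set (spectrum S)) :
  spectrum_max chi -> open V -> V chi ->
  exists2 g, set_val chi g & forall psi : spectrum S, set_val psi g -> V psi.
Proof.
move=> chimax [W oW <-] /= Wchi; have [[k chik] _ _] := spectrumP chi.
pose B g : set {ptws idem S -> bool} := [set psi | spectrum S psi /\ psi g].
pose F := filter_from [set g | set_val chi g] B.
have FF : Filter F.
  apply: filter_from_filter; first by exists k.
  move=> i j ci cj; exists (idemM i j); first by rewrite /= specM ci.
  by move=> psi [[se psiM p0]]; rewrite psiM => /andP[].
suff Fchi : F --> set_val chi.
  have [g cg gW] := Fchi W (open_nbhs_nbhs (conj oW Wchi)).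
  by exists g => // psi pg; apply: gW; split => //; exact: spectrumP.
apply/cvg_sup => i U [_ [[X oX <-] /= Xchi] /filterS]; apply.
have [chii|nchii] := boolP (set_val chi i).
  by exists i => // psi [_ pi] /=; rewrite pi -chii.
have [h ch hi] := spectrum_max_disjoint chimax nchii.
exists h => // psi [[_ psiM psi0] ph] /=.
have : psi (idemM h i) = false by rewrite hi.
by rewrite psiM ph /= => ->; rewrite -(negbTE nchii).
Qed.

Lemma tight_local_base (V : set (tight S)) : open V -> V !=set0 ->
  exists g psi, [/\ spectrum_max (set_val psi), char psi g &
    forall psi', char psi' g -> V psi'].
Proof.
move=> [W oW <-] [chi Wchi].
have clchi : closure (@spectrum_max S) (set_val chi) := set_valP chi.
have [|psi [psimax Wpsi]] := clchi W; first exact: open_nbhs_nbhs.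
have [g pg gW] := spectrum_max_base psimax oW Wpsi.
exists g, (SigSub (mem_set (subset_closure psimax))).
by split => // psi' pg'; exact: gW.
Qed.

Lemma exists_tight e : e <> idem0 S -> exists chi : tight S, char chi e.
Proof.
move=> /exists_spectrum_max[chi chimax ce].
by exists (SigSub (mem_set (subset_closure chimax))).
Qed.

Lemma char0 (chi : tight S) e : char chi e -> e <> idem0 S.
Proof.
have [_ _ chi0] := spectrumP (set_val chi).
by move=> + e0; rewrite e0 /char chi0.
Qed.

Lemma char_le (chi : tight S) e f : idem_le e f -> char chi e -> char chi f.
Proof. by move=> <-; rewrite charM => /andP[]. Qed.

Lemma idem_le_dom_mul s g h : idem_le h (idom (s * g)) -> idem_le h g.
Proof.
move=> hg; apply: idem_le_trans hg _; rewrite -iconj_dom iconj_idem.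
exact: idem_leMr.
Qed.

(** * Germs and the action of [Sc S] *)

Lemma germ_unitP s (chi : tight S) (h : char chi (idom s)) :
  range (@germ_unit S) (germ h) <-> exists2 f, char chi f & s * f = f.
Proof.
split => [[x _]|[f cf sf]].
  have := germ_unit_dom x; rewrite /germ_unit; move: (germ_unit_dom x).
  set k := projT1 _ => d + /germP[E [e [ke ce]]]; subst x.
  rewrite idom_idem => ck; exists (idemM k e); first by rewrite charM ck.
  by rewrite [idem_val (idemM k e)]idemC mulgA -ke -mulgA -(idemC k) mulgA idemE.
exists chi => //; have h' : char chi (idom (idem_val f)) by rewrite idom_idem.
by rewrite (germ_unitE h'); apply/germP; split => //; exists f; rewrite sf idemE.
Qed.

Lemma open_bisection_germ_nbhs s (U : set (tight S)) : open U ->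
  (forall chi (h : char chi (idom s)), U chi -> act h = chi) ->
  @open_bisection (tight_groupoid S) (germ_nbhs s U).
Proof.
move=> oU fixU; have srcI : {in germ_nbhs s U &, injective (@germ_src S)}.
  move=> _ _ /set_mem[psi [k [_ ->]]] /set_mem[psi' [k' [_ ->]]].
  by rewrite !germ_srcE => E; subst psi'; rewrite (bool_irrelevance k k').
split => //; first exact: germ_nbhs_open.
move=> g g' Ug Ug' E; apply: srcI => //; move: E.
have rngsrc x : x \in germ_nbhs s U -> germ_rng x = germ_src x.
  by move=> /set_mem[psi [k [Uk ->]]]; rewrite germ_rngE germ_srcE; exact: fixU.
by rewrite /= !rngsrc.
Qed.

(** [ScP] gives [h (s h s^-1) <> 0]; this is the same for [s^-1 h s]. *)
Lemma Sc_meet s h : Sc S s -> h <> idem0 S -> idem_le h (idom s) ->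
  idemM h (iconj s h) <> idem0 S.
Proof.
move=> /ScP Ss h0 hs E; apply: (Ss h h0 hs).
have := congr1 (iconj s^-1) E; rewrite iconjM iconj0 iconjKV.
set w := iconj _ h => wE.
have wd : idemM w (idom s^-1) = w by exact: iconj_le.
by rewrite -[RHS]wE !idemMA wd -idemMA idemMCA wd.
Qed.

Lemma Sc_act_max s (chi : spectrum S) e : Sc S s -> spectrum_max chi ->
  set_val chi (idom s) -> set_val chi (iconj s e) = set_val chi e.
Proof.
move=> Ss chimax h.
have -> : set_val chi (iconj s e) = set_val (spec_act h) e by [].
suff E : support (set_val chi) = support (set_val (spec_act h)).
  by move: E; rewrite predeqE => /(_ e)[chis schi]; apply/idP/idP;
    [exact: schi|exact: chis].
apply: (chimax (spec_act h)) => f cf; apply: (@spectrum_max_mem chi) => // k ck E.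
pose m := idemM k (idemM f (idom s)).
have cm : set_val chi m by rewrite !specM ck [set_val chi f]cf.
apply: (@Sc_meet s m) => //.
- by move=> m0; move: cm; rewrite m0; have [_ _ ->] := spectrumP chi.
- apply: idem_le_trans (idem_leMr _ _) (idem_leMr _ _).
have mf : idem_le m f := idem_le_trans (idem_leMr _ _) (idem_leMl _ _).
apply: idem_le0; rewrite -E; apply: idem_leM.
  exact: idem_le_trans (idem_leMl _ _) (idem_leMl _ _).
exact: idem_le_trans (idem_leMr _ _) (idem_le_iconj s mf).
Qed.

(** The maximal characters are dense, and equality of [chi e] and
    [chi (s^-1 e s)] is a closed condition. *)
Lemma Sc_act s (chi : tight S) (h : char chi (idom s)) : Sc S s -> act h = chi.
Proof.
move=> Ss; apply/charP/funext => e; rewrite char_act.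
have clchi : closure (@spectrum_max S) (set_val chi) := set_valP chi.
pose same f : set {ptws idem S -> bool} := [set psi | psi f = char chi f].
have open_same f : open (set_val @^-1` same f : set (spectrum S)).
  exists (same f) => //.
  have /continuousP : continuous (fun psi : {ptws idem S -> bool} => psi f).
    exact: (@proj_continuous (idem S) (fun=> bool) f).
  move=> /(_ [set x | x = char chi f]); apply; rewrite openE => b /= bE.
  by rewrite /interior nbhs_principalE => _ ->.
have [|psi [psimax [psid /= [Es Ee]]]] := clchi
   ([set psi : spectrum S | set_val psi (idom s)] `&`
    (set_val @^-1` same (iconj s e) `&` set_val @^-1` same e)).
  apply: open_nbhs_nbhs; split => //.
  by apply: openI; [exact: spec_open|exact: openI].
by rewrite -Es -Ee; exact: Sc_act_max.
Qed.

Lemma fixed_mul_Sc s g : idem_le g (idom s) ->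
  (forall chi (h : char chi (idom s)), char chi g -> act h = chi) ->
  Sc S (s * g).
Proof.
move=> gs fixg; apply/ScP => e e0 eg.
have [chi ce] := exists_tight e0.
have cg : char chi g by apply: char_le ce; exact: idem_le_dom_mul eg.
have cs : char chi (idom s) := char_le gs cg.
suff : char chi (idemM e (iconj (s * g)^-1 e)) by exact: char0.
have sgE : iconj (s * g)^-1 e = iconj s^-1 e.
  rewrite invM -iconj_comp (inv_idemS (idemE g)) iconj_idem.
  by rewrite (idemMC g) -!idemMA idemMM (idem_le_dom_mul eg).
by rewrite charM ce sgE -{1}(fixg _ cs cg) char_act iconjVK !charM ce cs.
Qed.

End Filters.

(** * Topological freeness *)

Lemma topologically_free_open_subgroupoid (G : etale_groupoid) (H : set (arr G))
    (oH : open H) (H1 : forall x, H (gunit x))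
    (HM : forall g h, H g -> H h -> src g = rng h -> H (gmul g h))
    (HV : forall g, H g -> H (ginv g)) :
  topologically_free G -> topologically_free (open_subgroupoid oH H1 HM HV).
Proof.
move=> freeG gamma [[W oW gE] srcI rngI] nunit.
have inI g : W g -> H g -> exists2 g' : H, gamma g' & set_val g' = g.
  by move=> Wg Hg; exists (SigSub (mem_set Hg)) => //; rewrite -gE.
rewrite -(freeG (set_val @` gamma)).
- congr interior; apply/seteqP; split => x [g].
    by move=> [[gs gr] gg]; exists (set_val g); split => //; exists g.
  by move=> [[gs gr] [g' gg' E]]; exists g'; split => //; rewrite -E in gs gr.
- split.
  + rewrite (_ : _ @` _ = W `&` H); first exact: openI.
    apply/seteqP; split => [_ [g gg <-]|g [Wg Hg]].
      by split; [rewrite -gE in gg|exact: set_valP].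
    by have [g' gg' <-] := inI g Wg Hg; exists g'.
  + move=> _ _ /set_mem[g gg <-] /set_mem[g' gg' <-] E.
    by congr set_val; apply: srcI => //; exact: mem_set.
  + move=> _ _ /set_mem[g gg <-] /set_mem[g' gg' <-] E.
    by congr set_val; apply: rngI => //; exact: mem_set.
- move=> _ [g gg <-] [x _ E]; apply: (nunit g gg).
  by exists x => //; apply: val_inj; rewrite /= E.
Qed.

Lemma Sc_free_fixed (S : inverseSemigroup0Type) (s : S) (g : idem S) :
  topologically_free (Sc_groupoid S) -> Sc S s -> g <> idem0 S ->
  idem_le g (idom s) ->
  exists g', [/\ g' <> idem0 S, idem_le g' g & s * g' = g'].
Proof.
move=> free Ss g0 gs; apply: contrapT => nfix.
pose U : set (tight S) := [set chi | char chi g].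
have oU : open U by exact: char_open.
have fixU (chi : tight S) (h : char chi (idom s)) : U chi -> act h = chi.
  by move=> _; exact: Sc_act.
have [obis srcI rngI] := open_bisection_germ_nbhs oU fixU.
have [chi chig] := exists_tight g0.
have := free (set_val @^-1` germ_nbhs s U).
rewrite predeqE => /(_ _ _ chi)[].
- split.
  + by exists (germ_nbhs s U).
  + move=> x y /set_mem xU /set_mem yU xy.
    by apply: val_inj; apply: srcI => //; exact: mem_set.
  + move=> x y /set_mem xU /set_mem yU xy.
    by apply: val_inj; apply: rngI => //; exact: mem_set.
- move=> x [psi [k [psig xE]]] [y _ yx].
  have /germ_unitP[f cf sf] : range (@germ_unit S) (germ k).
    by exists y => //; rewrite -xE -yx.
  apply: nfix; exists (idemM f g); split.
  + by apply: (@char0 _ psi); rewrite charM cf.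
  + exact: idem_leMr.
  + by rewrite /= mulgA sf.
move=> + _; apply.
apply: filterS (open_nbhs_nbhs (conj oU chig)) => psi psig.
have k : char psi (idom s) := char_le gs psig.
have Hk : Sc_germs (germ k) by exists s, psi, k.
exists (SigSub (mem_set Hk)); split; last by exists psi, k.
by split; rewrite /= ?germ_srcE// germ_rngE; exact: fixU.
Qed.

Lemma tight_free_of_fixed (S : inverseSemigroup0Type) :
  (forall (s : S) (g : idem S), Sc S s -> g <> idem0 S -> idem_le g (idom s) ->
    exists g', [/\ g' <> idem0 S, idem_le g' g & s * g' = g']) ->
  topologically_free (tight_groupoid S).
Proof.
move=> fixed gamma [og srcI rngI] nunit.
apply/seteqP; split => // chi0 chi0int.
have [x0 [[x0s _] gx0]] := nbhs_singleton chi0int.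
have [s [chi [h x0E]]] := germ_ind x0.
have chiE : chi0 = chi by rewrite -x0s x0E /= germ_srcE.
rewrite {}x0E in x0s gx0; rewrite {}chiE in chi0int.
have [U [oU Uchi sub]] := germ_nbhs_sub (open_nbhs_nbhs (conj og gx0)).
set Fix := [set x | _] in chi0int.
have oV : open (U `&` interior Fix `&` [set psi | char psi (idom s)]).
  by apply: openI; [apply: openI => //; exact: open_interior|exact: char_open].
have [|g [psi [psimax psig gV]]] := tight_local_base oV.
  by exists chi; split.
pose e := idemM g (idom s).
have es : idem_le e (idom s) by exact: idem_leMr.
have eg (psi' : tight S) : char psi' e -> char psi' g.
  by apply: char_le; exact: idem_leMl.
have gam (psi' : tight S) (k : char psi' (idom s)) : char psi' e -> gamma (germ k).
  by move=> /eg/gV[[Upsi _] _]; apply: sub; exists psi', k.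
have fixe (psi' : tight S) (k : char psi' (idom s)) :
    char psi' e -> act k = psi'.
  move=> ce; have [[_ /nbhs_singleton[y [[ys yr] gy]]] _] := gV _ (eg _ ce).
  (* the isotropy element of [gamma] at [psi'] is the germ of [s], since both
     have source [psi'] *)
  have yE : y = germ k.
    by apply: srcI; [exact: mem_set|apply/mem_set/gam|rewrite ys /= germ_srcE].
  by rewrite -germ_rngE -yE.
have e0 : e <> idem0 S.
  by have [_ psis] := gV _ psig; apply: (@char0 _ psi); rewrite charM psig.
have sgdom : idem_le e (idom (s * e)).
  rewrite -iconj_dom iconj_idem; apply: idem_leM; last exact: idemMM.
  exact: idem_leM (idemMM e) es.
have [g' [g'0 g'e sg']] := fixed _ e (fixed_mul_Sc es fixe) e0 sgdom.
have [psi' cg'] := exists_tight g'0.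
have k : char psi' (idom s) := char_le es (char_le g'e cg').
apply: (nunit (germ k)); first by apply: gam; exact: char_le cg'.
apply/germ_unitP; exists g' => //; rewrite -[in RHS]sg' -mulgA.
by congr (s * _); rewrite idemC -[in LHS]g'e.
Qed.

Theorem theorem5p11 (S : inverseSemigroup0Type) :
  [<-> topologically_free (tight_groupoid S);
       topologically_free (Sc_groupoid S);
       forall (s : S) (n : nat) (e : idem S) (f : 'I_n -> idem S),
         Sc S s ->
         (forall i, idem_le (f i) e) ->
         idem_le e (idom s) ->
         (exists g : idem S, [/\ g <> idem0 S, idem_le g e &
            forall i, idemM g (f i) = idem0 S]) ->
         exists g : idem S, [/\ g <> idem0 S, idem_le g e,
           forall i, idemM g (f i) = idem0 S & (s * g)%g = g]].
Proof.
tfae.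
- exact: topologically_free_open_subgroupoid.
- move=> free s n e f Ss _ es [g [g0 ge gf]].
  have [g' [g'0 g'g sg']] := Sc_free_fixed free Ss g0 (idem_le_trans ge es).
  exists g'; split => //; first exact: idem_le_trans ge.
  by move=> i; rewrite -g'g -idemMA gf idemMC idem0M.
- move=> fixed; apply: tight_free_of_fixed => s g Ss g0 gs.
  have [||g' [g'0 g'g _ sg']] := fixed s 0%N g (fun=> g) Ss _ gs.
  + by case.
  + by exists g; split => //; [exact: idemMM|case].
  + by exists g'.
Qed.
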